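(* There exist $\mathfrak{c}$ countably infinite transcendental groups each of which is homeomorphic to $\mathbb{Q}$ and is algebraically isomorphic (isomorphic as an abstract group) to the additive group of a vector space of countably infinite dimension over the field $\mathbb{A}$ of all algebraic numbers (and hence also to the additive group of a vector space of countably infinite dimension over $\mathbb{Q}$).
   Context: $\mathbb{C}$ denotes the additive topological group of complex numbers with its euclidean topology. A transcendental group is a subgroup $G$ of the topological group $\mathbb{C}$ (with the subspace topology) such that every element of $G$ except $0$ is a transcendental number. $\mathbb{A}\subset\mathbb{C}$ is the field of all algebraic numbers. $\mathfrak{c}$ is the cardinality of the continuum. $\mathbb{Q}$ has its usual topology as a subspace of $\mathbb{R}$. The groups are counted as distinct subgroups of $\mathbb{C}$. *)

(* Defs.v *)
From HB Require Import structures.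
From mathcomp Require Import all_boot all_order all_algebra.
From mathcomp Require Import complex.
From mathcomp Require Import all_classical all_reals all_analysis.

Set Implicit Arguments.
Unset Strict Implicit.
Unset Printing Implicit Defensive.

Import Order.TTheory GRing.Theory Num.Theory.
Import numFieldNormedType.Exports.

Local Open Scope classical_set_scope.
Local Open Scope complex_scope.
Local Open Scope ring_scope.

(* R[i] with the euclidean topology, given by the modulus; `_^o` is the
   topology every numFieldType carries. *)
HB.instance Definition _ (R : realType) :=
  PseudoPointedMetric.copy R[i] R[i]^o.

Section AlgebraicNumbers.
Variable R : realType.

Definition algebraic (z : R[i]) : Prop :=
  algebraicOver (ratr : rat -> R[i]) z.

Definition algebraic_pred : {pred R[i]} := fun z => `[< algebraic z >].

Fact algebraic_divring_closed : divring_closed algebraic_pred.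
Proof.
split; first exact/asboolP/algebraic1.
- by move=> x y /asboolP hx /asboolP hy; exact/asboolP/algebraic_sub.
- by move=> x y /asboolP hx /asboolP hy; exact/asboolP/algebraic_div.
Qed.

HB.instance Definition _ :=
  GRing.isDivringClosed.Build R[i] algebraic_pred algebraic_divring_closed.

(* The field of algebraic complex numbers is built inside R[i]; the library's
   [algC] is an abstract algebraic closure of the rationals. *)
Record algebraic_number := AlgebraicNumber {
  algebraic_val : R[i];
  _ : algebraic_val \in algebraic_pred
}.

HB.instance Definition _ := [isSub for algebraic_val].
HB.instance Definition _ := [Choice of algebraic_number by <:].
HB.instance Definition _ :=
  [SubChoice_isSubIntegralDomain of algebraic_number by <:].
HB.instance Definition _ :=
  [SubIntegralDomain_isSubField of algebraic_number by <:].

Definition transcendental_group (G : set R[i]) : Prop :=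
  zmod_closed [in G] /\ forall z, G z -> z <> 0 -> ~ algebraic z.

(* Only the restriction of f to G matters. *)
Definition group_isomorphic (G : set R[i]) (V : zmodType) : Prop :=
  exists f : R[i] -> V,
    set_bij G [set: V] f /\ {in G &, {morph f : x y / x + y}}.

End AlgebraicNumbers.

(* e is a basis indexed by nat; a finite linear combination of the e i is one
   over an initial segment of nat, padded with zero coefficients. *)
Definition countably_infinite_dim (F : fieldType) (V : lmodType F) : Prop :=
  exists e : nat -> V,
    (forall (n : nat) (a : nat -> F),
       \sum_(i < n) a i *: e i = 0 -> forall i, (i < n)%N -> a i = 0) /\
    (forall v : V, exists (n : nat) (a : nat -> F),
       v = \sum_(i < n) a i *: e i).

Definition homeomorphic (X Y : topologicalType) : Prop :=
  exists (f : X -> Y) (g : Y -> X),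
    [/\ cancel f g, cancel g f, continuous f & continuous g].

(* Main.v *)
From HB Require Import structures.
Require Import Defs.
From mathcomp Require Import all_boot all_order all_algebra.
From mathcomp Require Import complex.
From mathcomp Require Import all_classical all_reals all_analysis.
Set Implicit Arguments.
Unset Strict Implicit.
Unset Printing Implicit Defensive.
Import Order.TTheory GRing.Theory Num.Theory.
Import numFieldNormedType.Exports.
Local Open Scope classical_set_scope.
Local Open Scope card_scope.
Local Open Scope complex_scope.
Local Open Scope ring_scope.

(** Fix a transcendental real number t and, for an infinite set N of positive
exponents, let G_N be the rational span of the powers t^n with n in N. A nonzero
element of G_N is p(t) for a nonconstant rational polynomial p, so it is
transcendental: if q annihilates p(t), then q o p annihilates t. Exponent sets
coding the real numbers give a continuum of distinct groups. Each G_N is a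
countable dense subset of the real line, so by Cantor's back-and-forth argument
it is order isomorphic, hence homeomorphic, to Q. As a group it is a rational
vector space of countably infinite dimension, and so is A[X], which is therefore
isomorphic to it. *)

(** * Countable dense subsets of the real line *)

Section OrderIsomorphism.
Variable R : realType.

Definition dense_image (X : Type) (u : X -> R) :=
  forall a b : R, a < b -> exists x, a < u x < b.

(** Bounds are met one at a time: a point violating a new bound is replaced by one just beyond it,
    which then respects the earlier bounds on that side too. *)
Lemma dense_between (Y : Type) (v : Y -> R) (L U : seq R) :
  dense_image v -> (forall l h, l \in L -> h \in U -> l < h) ->
  exists y, (forall l, l \in L -> l < v y) /\ (forall h, h \in U -> v y < h).
Proof.
move=> dv; elim: L => [|l L IHL] LU.
  elim: U {LU} => [|h U [y [_ yU]]].
    by have [y _] := dv 0 1 ltr01; exists y.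
  case: (ltP (v y) h) => [yh|hy].
    by exists y; split=> // k; rewrite inE => /predU1P[->//|/yU].
  have [y' /andP[_ y'h]] := dv (h - 1) h ltac:(by rewrite gtrBl).
  exists y'; split=> // k; rewrite inE => /predU1P[->//|/yU].
  exact/lt_trans/(lt_le_trans y'h).
have [|y [yL yU]] := IHL; first by move=> a b aL; apply: LU; rewrite inE aL orbT.
case: (ltP l (v y)) => [ly|yl].
  by exists y; split=> // k; rewrite inE => /predU1P[->//|/yL].
(* Here [v y <= l], so [l] exceeds every member of [L] and is the only lower bound left to meet. *)
suff [y' [ly' y'U]] : exists y', l < v y' /\ forall h, h \in U -> v y' < h.
  exists y'; split=> // k; rewrite inE => /predU1P[->//|/yL].
  by move=> ky; apply: lt_trans ky (le_lt_trans yl ly').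
have {}LU h : h \in U -> l < h by apply: LU; rewrite mem_head.
elim: U LU {yU IHL} => [|h U IHU] LU.
  have [y' /andP[ly' _]] := dv l (l + 1) ltac:(by rewrite ltrDl).
  by exists y'.
have [|y' [ly' y'U]] := IHU; first by move=> k kU; apply: LU; rewrite inE kU orbT.
case: (ltP (v y') h) => [y'h|hy'].
  by exists y'; split=> // k; rewrite inE => /predU1P[->//|/y'U].
have [y'' /andP[ly'' y''h]] := dv l h (LU h (mem_head _ _)).
exists y''; split=> // k; rewrite inE => /predU1P[->//|/y'U].
exact/lt_trans/(lt_le_trans y''h).
Qed.

(** A finite partial order isomorphism. As [p] and [q] can be exchanged, equal [u]-values correspond
    to equal [v]-values. *)
Definition order_matching (X Y : eqType) (u : X -> R) (v : Y -> R)
    (s : seq (X * Y)) :=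
  forall p q, p \in s -> q \in s -> (u p.1 < u q.1) = (v p.2 < v q.2).

(** If [u x] is already the value of a matched point, that point's partner is reused; otherwise
    density places [y] between the partners of the matched points below and above [x]. *)
Lemma order_matching_extend (X Y : eqType) (u : X -> R) (v : Y -> R)
    (s : seq (X * Y)) (x : X) :
  dense_image v -> order_matching u v s ->
  exists y, order_matching u v ((x, y) :: s).
Proof.
move=> dv ms; have [[p ps px]|nx] := pselect (exists2 p, p \in s & u p.1 = u x).
  exists p.2 => a b; rewrite !inE.
  by move=> /predU1P[->|as_] /predU1P[->|bs] /=; rewrite -?px ?ltxx//; apply: ms.
pose L := [seq v p.2 | p <- s & u p.1 < u x].
pose U := [seq v p.2 | p <- s & u x < u p.1].
have [l h /mapP[p] + -> /mapP[q] + ->|y [yL yU]] := @dense_between _ v L U dv.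
  rewrite !mem_filter => /andP[px ps] /andP[qx qs].
  by rewrite -ms//; exact: lt_trans px qx.
have key p : p \in s -> (u p.1 < u x) = (v p.2 < v y) /\
                        (u x < u p.1) = (v y < v p.2).
  move=> ps; case: (ltgtP (u p.1) (u x)) => [px|xp|px]; last first.
  - by case: nx; exists p.
  - have yp : v y < v p.2 by apply/yU/mapP; exists p; rewrite // mem_filter xp.
    by rewrite yp ltNge (ltW yp).
  - have yp : v p.2 < v y by apply/yL/mapP; exists p; rewrite // mem_filter px.
    by rewrite yp ltNge (ltW yp).
exists y => a b; rewrite !inE => /predU1P[->|as_] /predU1P[->|bs] /=.
- by rewrite !ltxx.
- by case: (key _ bs).
- by case: (key _ as_).
- exact: ms.
Qed.

Lemma order_matching_swap (X Y : eqType) (u : X -> R) (v : Y -> R)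
    (s : seq (X * Y)) :
  order_matching u v s -> order_matching v u [seq (p.2, p.1) | p <- s].
Proof. by move=> ms _ _ /mapP[p ps ->] /mapP[q qs ->] /=; rewrite ms. Qed.

(* Cantor's back-and-forth argument. *)
Lemma dense_order_isomorphism (X Y : eqType) (u : X -> R) (v : Y -> R) :
  countable [set: X] -> countable [set: Y] -> injective u -> injective v ->
  dense_image u -> dense_image v ->
  exists (f : X -> Y) (g : Y -> X),
    [/\ cancel f g, cancel g f &
        forall x x', (u x < u x') = (v (f x) < v (f x'))].
Proof.
move=> /countable_injP[i ii] /countable_injP[j jj] ui vi du dv.
have {}ii : injective i by move=> x y; apply: ii; rewrite in_setT.
have {}jj : injective j by move=> x y; apply: jj; rewrite in_setT.
have forth n s : order_matching u v s -> exists s', [/\ order_matching u v s',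
    {subset s <= s'} & forall x, i x = n -> exists y, (x, y) \in s'].
  move=> ms; have [[x xn]|nx] := pselect (exists x, i x = n); last first.
    by exists s; split=> // x xn; case: nx; exists x.
  have [y my] := order_matching_extend x dv ms.
  exists ((x, y) :: s); split=> // [p ps|x']; first by rewrite inE ps orbT.
  by rewrite -xn => /ii ->; exists y; rewrite mem_head.
have back n s : order_matching u v s -> exists s', [/\ order_matching u v s',
    {subset s <= s'} & forall y, j y = n -> exists x, (x, y) \in s'].
  move=> ms; have [[y yn]|ny] := pselect (exists y, j y = n); last first.
    by exists s; split=> // y yn; case: ny; exists y.
  have [x /order_matching_swap mx] :=
    order_matching_extend y du (order_matching_swap ms).
  rewrite /= -map_comp (@eq_map _ _ _ id) ?map_id in mx; last by case.
  exists ((x, y) :: s); split=> // [p ps|y']; first by rewrite inE ps orbT.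
  by rewrite -yn => /jj ->; exists x; rewrite mem_head.
(* The hypothesis on [s] sits under the existential, so that [choice] yields a step function defined
   on all lists. *)
have step n s : exists s', order_matching u v s -> [/\ order_matching u v s',
    {subset s <= s'}, forall x, i x = n -> exists y, (x, y) \in s' &
    forall y, j y = n -> exists x, (x, y) \in s'].
  have [ms|] := pselect (order_matching u v s); last by exists s.
  have [s1 [ms1 ss1 s1n]] := forth n s ms.
  have [s2 [ms2 ss2 s2n]] := back n s1 ms1.
  exists s2 => _; split=> // [p /ss1/ss2//|x /s1n[y /ss2]].
  by exists y.
have {forth back step} [F FP] := choice (fun ns => step ns.1 ns.2).
(* Stage [n.+1] has matched the elements of code [n], if any, on both sides. *)
pose fix ss n := if n is m.+1 then F (m, ss m) else [::].
have mss n : order_matching u v (ss n).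
  by elim: n => [|n IH] //=; have [] := FP (n, ss n) IH.
have sub_ss m n : (m <= n)%N -> {subset ss m <= ss n}.
  elim: n => [|n IH]; first by rewrite leqn0 => /eqP ->.
  rewrite leq_eqVlt => /predU1P[->//|]; rewrite ltnS => /IH sub p /sub.
  by have [_ + _ _] := FP (n, ss n) (mss n); apply.
have match2 m n p q : p \in ss m -> q \in ss n -> (u p.1 < u q.1) = (v p.2 < v q.2).
  move=> pm qn; apply: (mss (maxn m n)).
    by apply: sub_ss pm; rewrite leq_maxl.
  by apply: sub_ss qn; rewrite leq_maxr.
have /choice[f fP] (x : X) : exists y n, (x, y) \in ss n.
  have [_ _ + _] := FP (i x, ss (i x)) (mss _).
  by move=> /(_ x erefl)[y xy]; exists y, (i x).+1.
have /choice[g gP] (y : Y) : exists x n, (x, y) \in ss n.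
  have [_ _ _] := FP (j y, ss (j y)) (mss _).
  by move=> /(_ y erefl)[x xy]; exists x, (j y).+1.
exists f, g; split=> [x|y|x x'].
- have [m xm] := fP x; have [n xn] := gP (f x); apply: ui.
  (* The pairs [(x, f x)] and [(g (f x), f x)] share their second entry, which excludes both strict
     inequalities between the first ones. *)
  have /= := match2 _ _ _ _ xm xn; have /= := match2 _ _ _ _ xn xm.
  by rewrite !ltxx; case: ltgtP.
- have [m xm] := fP (g y); have [n xn] := gP y; apply: vi.
  have /= := match2 _ _ _ _ xm xn; have /= := match2 _ _ _ _ xn xm.
  by rewrite !ltxx; case: ltgtP.
- by have [m xm] := fP x; have [n xn] := fP x'; apply: (match2 _ _ _ _ xm xn).
Qed.

(** The topology of [T] is the one pulled back from the line along [u]. *)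
Definition real_embedding (T : topologicalType) (u : T -> R) :=
  forall x (A : set T), nbhs x A <->
    exists2 e : R, 0 < e & forall x', `|u x' - u x| < e -> A x'.

(** Points of [Y] within [e] of [f x], one on each side, are pulled back by [g] to an order interval
    around [x], whose image stays between them. *)
Lemma order_isomorphism_continuous (X Y : topologicalType) (u : X -> R)
    (v : Y -> R) (f : X -> Y) (g : Y -> X) :
  real_embedding u -> real_embedding v -> dense_image v -> cancel g f ->
  (forall x x', (u x < u x') = (v (f x) < v (f x'))) -> continuous f.
Proof.
move=> eu ev dv gK mf x A /ev[e e0 fA]; apply/eu.
have [a /andP[xa ax]] : exists a, v (f x) - e < v a < v (f x).
  by apply: dv; rewrite gtrBl.
have [b /andP[xb bx]] : exists a, v (f x) < v a < v (f x) + e.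
  by apply: dv; rewrite ltrDl.
have ga : u (g a) < u x by rewrite mf gK.
have gb : u x < u (g b) by rewrite mf gK.
exists (Num.min (u x - u (g a)) (u (g b) - u x)).
  by rewrite lt_min !subr_gt0 ga gb.
move=> x'; rewrite lt_min => /andP[x'a x'b]; apply: fA.
have ax' : v a < v (f x').
  rewrite -{1}(gK a) -mf; move: x'a; rewrite ltr_distl => /andP[+ _].
  by rewrite opprB addrC subrK.
have bx' : v (f x') < v b.
  rewrite -(gK b) -mf; move: x'b; rewrite ltr_distl => /andP[_].
  by rewrite addrC subrK.
by rewrite ltr_distl (lt_trans xa ax') (lt_trans bx' bx).
Qed.

End OrderIsomorphism.

(** * Bases of countable vector spaces *)

Section Bases.
Variables (F : fieldType) (V : lmodType F).
Implicit Types (e : nat -> V) (p q : {poly F}).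

Definition independent e :=
  forall (n : nat) (a : nat -> F),
    \sum_(i < n) a i *: e i = 0 -> forall i, (i < n)%N -> a i = 0.

(** Polynomials serve as finitely supported coefficient sequences: this is the linear map sending
    ['X^i] to [e i]. *)
Definition lincomb e p : V := \sum_(i < size p) p`_i *: e i.

Lemma lincomb_wide e p n :
  (size p <= n)%N -> lincomb e p = \sum_(i < n) p`_i *: e i.
Proof.
move=> pn; rewrite /lincomb (big_ord_widen n (fun i => p`_i *: e i))// big_mkcond.
by apply: eq_bigr => i _; case: ltnP => // /(nth_default 0) ->; rewrite scale0r.
Qed.

Lemma lincombD e : {morph lincomb e : p q / p + q}.
Proof.
move=> p q; pose n := maxn (size p) (size q).
rewrite !(@lincomb_wide _ _ n) ?leq_maxl ?leq_maxr ?size_polyD// -big_split/=.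
by apply: eq_bigr => i _; rewrite coefD scalerDl.
Qed.

Lemma lincombZX e c n : lincomb e (c *: 'X^n) = c *: e n.
Proof.
rewrite (@lincomb_wide _ _ n.+1); last first.
  by rewrite (leq_trans (size_scale_leq _ _))// size_polyXn.
rewrite big_ord_recr/= coefZ coefXn eqxx mulr1 big1 ?add0r// => i _.
by rewrite coefZ coefXn ltn_eqF// mulr0 scale0r.
Qed.

Lemma lincomb_poly e n a : lincomb e (\poly_(i < n) a i) = \sum_(i < n) a i *: e i.
Proof.
rewrite (lincomb_wide _ (size_poly _ _)); apply: eq_bigr => i _.
by rewrite coef_poly ltn_ord.
Qed.

Lemma lincombN e p : lincomb e (- p) = - lincomb e p.
Proof.
by rewrite /lincomb size_polyN -sumrN; apply: eq_bigr => i _; rewrite coefN scaleNr.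
Qed.

Lemma lincomb_inj e : independent e -> injective (lincomb e).
Proof.
move=> ie p q /eqP; rewrite -subr_eq0 -lincombN -lincombD => /eqP pq0.
apply/eqP; rewrite -subr_eq0; apply/eqP/polyP => i; rewrite coef0.
have [/(ie _ _ pq0)//|] := ltnP i (size (p - q)).
exact: nth_default.
Qed.

Lemma lincomb_bij : countably_infinite_dim V ->
  exists2 e, injective (lincomb e) & forall v, exists p, lincomb e p = v.
Proof.
move=> [e [ie se]]; exists e; first exact: lincomb_inj.
by move=> v; have [n [a ->]] := se v; exists (\poly_(i < n) a i); apply: lincomb_poly.
Qed.

Definition spanned (s : seq V) (v : V) :=
  exists a : nat -> F, v = \sum_(i < size s) a i *: s`_i.

Lemma spanned_rcons s x v : spanned s v -> spanned (rcons s x) v.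
Proof.
move=> [a ->]; exists (fun i => if (i < size s)%N then a i else 0).
rewrite size_rcons big_ord_recr/= ltnn scale0r addr0.
by apply: eq_bigr => i _; rewrite ltn_ord nth_rcons ltn_ord.
Qed.

Lemma spanned_last s x : spanned (rcons s x) x.
Proof.
exists (fun i => (i == size s)%:R).
rewrite size_rcons big_ord_recr/= eqxx scale1r nth_rcons ltnn eqxx.
by rewrite big1 ?add0r// => i _; rewrite ltn_eqF// scale0r.
Qed.

(* Greedy basis: each new vector is the first one, in an enumeration of [V],
   outside the span of the previous ones. *)
Lemma countably_infinite_dim_of_countable :
  countable [set: V] -> (forall s : seq V, exists v, ~ spanned s v) ->
  countably_infinite_dim V.
Proof.
move=> /countable_injP[k kk] inf.
have {}kk : injective k by move=> x y; apply: kk; rewrite in_setT.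
(* [F0 s] has the least code among the vectors outside the span of [s]. *)
have /choice[F0 FP] (s : seq V) : exists x, ~ spanned s x /\
    forall y, (k y < k x)%N -> spanned s y.
  have ex : exists n, `[< exists2 x, k x = n & ~ spanned s x >].
    by have [v] := inf s; exists (k v); apply/asboolP; exists v.
  case: (ex_minnP ex) => n /asboolP[x xn sx] nmin; exists x; split=> // y.
  rewrite xn => yn; apply: contrapT => sy.
  have /nmin : `[< exists2 x, k x = k y & ~ spanned s x >] by apply/asboolP; exists y.
  by rewrite leqNgt yn.
pose ss n := iter n (fun s => rcons s (F0 s)) [::].
pose e n := F0 (ss n).
have sse n : ss n = mkseq e n by elim: n => //= n IH; rewrite mkseqS -IH.
have spe n v : spanned (ss n) v <-> exists a : nat -> F, v = \sum_(i < n) a i *: e i.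
  rewrite sse /spanned size_mkseq; split=> -[a ->]; exists a;
  by apply: eq_bigr => i _; rewrite nth_mkseq.
exists e; split=> [n a|v].
  elim: n => [//|n IH]; rewrite big_ord_recr/= => h.
  have an : a n = 0.
    (* Dividing by a nonzero last coefficient would put [e n] in the span of the earlier vectors. *)
    apply: contrapT => /eqP an; have [+ _] := FP (ss n); case; apply/spe.
    exists (fun i => - (a n)^-1 * a i).
    under eq_bigr => i _ do rewrite -scalerA.
    rewrite -scaler_sumr; move/eqP: h; rewrite addr_eq0 => /eqP ->.
    by rewrite scalerN scaleNr opprK scalerA mulVf// scale1r.
  move: h; rewrite an scale0r addr0 => /IH h i.
  by rewrite ltnS leq_eqVlt => /predU1P[->//|/h].
suff /(_ (k v).+1 v (ltnSn _))/spe[a va] : forall n x, (k x < n)%N -> spanned (ss n) x.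
  by exists (k v).+1, a.
elim=> [//|n IH] x; rewrite ltnS leq_eqVlt => /predU1P[xn|/IH]; last first.
  exact: spanned_rcons.
(* Let [x] have code [n]. If [e n] has a larger code, [x] is spanned by minimality; if the codes
   agree, [x] is [e n]; a smaller code would put [e n] in the span of [ss n] by induction. *)
have [_ +] := FP (ss n); case: (ltnP (k x) (k (e n))) => [xe /(_ _ xe)|].
  exact: spanned_rcons.
rewrite leq_eqVlt => /predU1P[/kk <- _|]; first exact: spanned_last.
by rewrite xn => /IH; have [+ _] := FP (ss n) => /[apply].
Qed.

End Bases.

Lemma countably_infinite_dim_poly (F : fieldType) : countably_infinite_dim {poly F}.
Proof.
exists (fun i => 'X^i); split=> [n a|p].
  rewrite -poly_def => /polyP h i ni.
  by have := h i; rewrite coef_poly ni coef0.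
by exists (size p), (nth 0 p); rewrite -poly_def coefK.
Qed.

(** Through [lincomb], both spaces are identified with [{poly F}]. *)
Lemma countably_infinite_dim_isomorphic (F : fieldType) (V W : lmodType F) :
  countably_infinite_dim V -> countably_infinite_dim W ->
  exists2 f : V -> W, bijective f & {morph f : x y / x + y}.
Proof.
move=> /lincomb_bij[d di ds] /lincomb_bij[e ei es].
have [d' dK] := choice ds; have [e' eK] := choice es.
have d'K : cancel (lincomb d) d' by move=> p; apply: di.
have e'K : cancel (lincomb e) e' by move=> p; apply: ei.
exists (lincomb e \o d') => [|x y /=].
  by exists (lincomb d \o e') => x /=; rewrite ?e'K ?d'K ?dK ?eK.
by rewrite -lincombD; congr lincomb; apply: di; rewrite lincombD !dK.
Qed.

Lemma group_isomorphic_trans (R : realType) (G : set R[i]) (V W : zmodType)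
    (f : V -> W) :
  bijective f -> {morph f : x y / x + y} ->
  group_isomorphic G V -> group_isomorphic G W.
Proof.
move=> [g fK gK] fD [h [[_ hi hs] hD]]; exists (f \o h); split.
  split=> // [x y xG yG /= /(can_inj fK)|w _]; first exact: hi.
  by have [x xG xh] := hs (g w) I; exists x => //=; rewrite xh gK.
by move=> x y xG yG /=; rewrite hD// fD.
Qed.

(** * Restriction of scalars along a morphism of fields *)

Section RestrictScalars.
Variables (K F : fieldType) (s : {rmorphism K -> F}) (V : lmodType F).

(** An alias of [V] that records the morphism, so that the scaling by [K] can be attached to it
    beside the scaling of [V] by [F]. *)
Definition restrict_scalars of {rmorphism K -> F} : Type := V.
Local Notation Vs := (restrict_scalars s).

HB.instance Definition _ := GRing.Zmodule.copy Vs V.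

Definition restricted_scale (c : K) (v : Vs) : Vs := s c *: (v : V).

Fact restricted_scaleA a b v :
  restricted_scale a (restricted_scale b v) = restricted_scale (a * b) v.
Proof. by rewrite /restricted_scale rmorphM scalerA. Qed.

Fact restricted_scale1 : left_id 1 restricted_scale.
Proof. by move=> v; rewrite /restricted_scale rmorph1 scale1r. Qed.

Fact restricted_scaleDr : right_distributive restricted_scale +%R.
Proof. by move=> a u v; apply: scalerDr. Qed.

Fact restricted_scaleDl v : {morph restricted_scale^~ v : a b / a + b}.
Proof. by move=> a b; rewrite /restricted_scale rmorphD; apply: scalerDl. Qed.

HB.instance Definition _ := GRing.Zmodule_isLmodule.Build K Vs
  restricted_scaleA restricted_scale1 restricted_scaleDr restricted_scaleDl.

End RestrictScalars.

(** * Countability of the algebraic numbers and the rational dimension of [{poly A}] *)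

Section AlgebraicNumbers.
Variable R : realType.
Local Notation A := (algebraic_number R).

Lemma algebraic_ratr (q : rat) : ratr q \in @algebraic_pred R.
Proof. exact/asboolP/algebraic_id. Qed.

Definition algebraic_of_rat (q : rat) : A := AlgebraicNumber (algebraic_ratr q).

Fact algebraic_of_rat_zmod_morphism : zmod_morphism algebraic_of_rat.
Proof. by move=> p q; apply: val_inj; rewrite /= !rmorphB. Qed.

Fact algebraic_of_rat_monoid_morphism : monoid_morphism algebraic_of_rat.
Proof.
by split=> [|p q]; apply: val_inj; rewrite /= (rmorph1, rmorphM).
Qed.

HB.instance Definition _ := GRing.isZmodMorphism.Build rat A algebraic_of_rat
  algebraic_of_rat_zmod_morphism.
HB.instance Definition _ := GRing.isMonoidMorphism.Build rat A algebraic_of_rat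
  algebraic_of_rat_monoid_morphism.

Lemma countable_algebraic : countable [set z : R[i] | algebraic z].
Proof.
pose roots (p : {poly rat}) := [set z : R[i] | p != 0 /\ root (map_poly ratr p) z].
apply: (@sub_countable _ _ _ (\bigcup_(p in [set: {poly rat}]) roots p)).
  by apply: subset_card_le => z /= [p p0 pz]; exists p.
apply: bigcup_countable => [|p _]; first exact: countableP.
have [->|p0] := eqVneq p 0.
  by apply: (@sub_countable _ _ _ set0) => //; apply: subset_card_le => z [/eqP].
(* Since [R[i]] is algebraically closed, [p] splits there and its roots form the finite list [r]. *)
have [r pr] := closed_field_poly_normal (map_poly ratr p : {poly R[i]}).
apply: finite_set_countable; apply: (@sub_finite_set _ _ [set` r]) => // z [_].
by rewrite pr rootZ ?root_prod_XsubC// lead_coef_eq0 map_poly_eq0.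
Qed.

Lemma countable_poly_algebraic : countable [set: {poly A}].
Proof.
have /countable_injP[k kk] := countable_algebraic.
apply/countable_injP; exists (fun p => pickle [seq k (val a) | a <- p]).
move=> p q _ _ /(pcan_inj pickleK) /inj_map pq; apply/val_inj/pq => a b ab.
by apply/val_inj/kk; rewrite ?inE//; [case: a ab|case: b ab] => x /= /asboolP.
Qed.

(** The space is countable, and no finite list spans it because scaling and adding do not raise
    degrees above their maximum. *)
Lemma countably_infinite_dim_poly_algebraic_rat :
  countably_infinite_dim (restrict_scalars {poly A} algebraic_of_rat).
Proof.
apply: countably_infinite_dim_of_countable; first exact: countable_poly_algebraic.
move=> s; pose n := \max_(p <- s) size (p : {poly A}).
exists ('X^n : {poly A}) => -[a /(congr1 (fun p : {poly A} => size p))].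
rewrite size_polyXn => nE; have : (n.+1 <= n)%N.
  rewrite nE; apply: (big_ind (fun p : {poly A} => (size p <= n)%N)) => /=.
  - by rewrite size_poly0.
  - move=> p q pn qn; apply: leq_trans (size_polyD _ _) _.
    by rewrite geq_max pn.
  - move=> i _; apply: leq_trans (size_scale_leq _ _) _.
    exact: (@leq_bigmax_seq {poly A} s xpredT (fun p => size p) _ (mem_nth _ _)).
by rewrite ltnn.
Qed.

End AlgebraicNumbers.

(** * Subspaces of the complex plane homeomorphic to the rationals *)

(** The second condition compares points of [A] only, so it can hold for the real part, which does
    not separate points of the whole plane. *)
Lemma real_embedding_set_type (R : realType) (T : topologicalType) (A : set T)
    (w : T -> R) :
  continuous w ->
  (forall x (B : set T), nbhs x B -> exists2 e : R, 0 < e &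
     forall y, A y -> A x -> `|w y - w x| < e -> B y) ->
  real_embedding (fun x : set_type A => w (val x)).
Proof.
move=> wc wo x B; split=> [[_ /= [[C Cop <-] Cx CB]]|[e e0 eB]].
  have [e e0 eC] := wo (val x) C (open_nbhs_nbhs (conj Cop Cx)).
  exists e => // y ye; apply: CB; apply: eC ye; exact: set_valP.
have : nbhs (val x) (w @^-1` ball (w (val x)) e) by apply: wc; apply: nbhsx_ballx.
move=> /(@initial_continuous (set_type A) T set_val x); apply: (@filterS _ (nbhs x) _) => y ye.
by apply: eB; rewrite distrC.
Qed.

Lemma real_embedding_real (R : realType) (A : set R) :
  real_embedding (fun x : set_type A => val x).
Proof.
apply: (@real_embedding_set_type R R A id) => [x|x B /nbhs_ballP[e e0 eB]].
  exact: cvg_id.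
by exists e => // y _ _ xy; apply: eB; rewrite /ball/= distrC.
Qed.

Lemma real_embedding_complex_real (R : realType) (A : set R[i]) :
  (forall z, A z -> complex.Im z = 0) ->
  real_embedding (fun z : set_type A => complex.Re (val z)).
Proof.
move=> A0; apply: (@real_embedding_set_type R R[i] A (@complex.Re R)).
  move=> x B /nbhs_ballP[e e0 eB]; apply/nbhs_ballP.
  exists e%:C => [|y]; first by rewrite /= ltcR.
  rewrite /ball/= => xy; apply: eB; rewrite /ball/= -ltcR.
  by apply: le_lt_trans xy; rewrite -raddfB; exact: normc_ge_Re.
(* Radii of balls in [R[i]] are themselves complex; [0 < e] forces [e] to be real, with positive
   real part. *)
move=> x B /nbhs_ballP[e e0 eB]; exists (complex.Re e).
  by move: e0; case: e eB => a b /= _; rewrite ltcE/= => /andP[].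
move=> y Ay Ax xy; apply: eB; rewrite /ball/= distrC.
move: xy (A0 _ Ax) (A0 _ Ay); case: x y {Ax Ay} => a b [c d] /= + -> ->.
move: e0; case: e => e f; rewrite !ltcE/= => /andP[/eqP <- e0] xy.
by rewrite eqxx subrr expr0n/= addr0 sqrtr_sqr.
Qed.

Lemma dense_ratr (R : realType) (w : R) : w != 0 ->
  dense_image (fun q : rat => ratr q * w).
Proof.
move=> w0 a b ab; have [wp|wn] := ltP 0 w.
  have /rat_in_itvoo[q] : a / w < b / w by rewrite ltr_pM2r// invr_gt0.
  by rewrite in_itv/= ltr_pdivrMr// ltr_pdivlMr//; exists q.
have {w0}wn : w < 0 by rewrite lt_neqAle w0.
have /rat_in_itvoo[q] : b / w < a / w by rewrite ltr_nM2r// invr_lt0.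
by rewrite in_itv/= ltr_ndivrMr// ltr_ndivlMr// andbC; exists q.
Qed.

(** Back-and-forth matches [G], ordered by real part, with the rationals inside [R]. Both subspace
    topologies come from the line, so the order isomorphism and its inverse are continuous. *)
Lemma dense_homeomorphic_rat (R : realType) (G : set R[i]) :
  countable G -> (forall z, G z -> complex.Im z = 0) ->
  dense_image (fun z : set_type G => complex.Re (val z)) ->
  homeomorphic (set_type G) (set_type (range (ratr : rat -> R))).
Proof.
move=> cG G0 dG; pose u (z : set_type G) := complex.Re (val z).
pose v (q : set_type (range (ratr : rat -> R))) := val q.
have ui : injective u.
  move=> x y xy; apply: val_inj; move: (G0 _ (set_valP x)) (G0 _ (set_valP y)).
  move: xy; rewrite /u.
  by case: (\val x) => a b; case: (\val y) => c d /= -> -> ->.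
have vi : injective v by apply: val_inj.
have cv : countable (range (ratr : rat -> R)).
  exact: sub_countable (card_image_le _ _) (countableP _).
have dv : dense_image v.
  move=> a b /rat_in_itvoo[q]; rewrite in_itv/= => qab.
  have rq : range (ratr : rat -> R) (ratr q) by exists q.
  by exists (SigSub (mem_set rq)).
have cT (T : Type) (A : set T) : countable A -> countable [set: set_type A].
  by move=> cA; rewrite (eq_countable (card_setT A)).
have [f [g [fK gK mf]]] :=
  dense_order_isomorphism (cT _ _ cG) (cT _ _ cv) ui vi dG dv.
have eu := real_embedding_complex_real G0.
have ev := @real_embedding_real R (range (ratr : rat -> R)).
exists f, g; split=> //; first exact: order_isomorphism_continuous eu ev dv gK mf.
apply: (order_isomorphism_continuous ev eu dG fK) => x x'.
by rewrite [RHS]mf !gK.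
Qed.

Lemma group_isomorphic_range (R : realType) (V : zmodType) (phi : V -> R[i]) :
  injective phi -> {morph phi : x y / x + y} -> group_isomorphic (range phi) V.
Proof.
(* [f] inverts [phi] on its range; elsewhere 0 serves as a default value. *)
move=> ip phiD; have /choice[f fP] (z : R[i]) :
    exists x, range phi z -> phi x = z.
  by have [[x _ <-]|] := pselect (range phi z); [exists x|exists 0].
have fK x : f (phi x) = x by apply: ip; apply: fP; exists x.
exists f; split; first split=> [//|_ _ /set_mem[x _ <-] /set_mem[y _ <-]|x _].
- by rewrite !fK => ->.
- by exists (phi x); [exists x|].
- by move=> _ _ /set_mem[x _ <-] /set_mem[y _ <-]; rewrite -phiD !fK.
Qed.

(** Otherwise [R] would be countable and the unit interval would have Lebesgue measure 0 instead of
    1. *)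
Lemma exists_transcendental (R : realType) : exists t : R, ~ algebraic t%:C.
Proof.
apply: contrapT => alg.
have cR : countable [set: R].
  have /countable_injP[k kk] := @countable_algebraic R.
  apply/countable_injP; exists (k \o real_complex R) => x y _ _ /kk.
  have az (z : R) : algebraic z%:C by apply: contrapT => nz; apply: alg; exists z.
  by move=> /(_ (mem_set (az x)) (mem_set (az y)))[].
have /countable_lebesgue_measure0 : countable (`]0, 1[ : set R).
  exact: sub_countable (card_leT _) cR.
rewrite lebesgue_measure_itv/= lte_fin ltr01 -EFinB subr0 => -[/eqP].
by rewrite oner_eq0.
Qed.

(** * Groups spanned by powers of a transcendental number *)

Section Powers.
Variables (R : realType) (t : R).
Hypothesis tt : ~ algebraic t%:C.

Definition rat_horner (p : {poly rat}) : R := (map_poly ratr p).[t].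

Lemma rat_hornerD : {morph rat_horner : p q / p + q}.
Proof. by move=> p q; rewrite /rat_horner rmorphD hornerD. Qed.

Lemma rat_hornerE p : (rat_horner p)%:C = (map_poly ratr p).[t%:C].
Proof.
rewrite /rat_horner -horner_map -map_poly_comp; congr _.[_].
by apply: eq_map_poly => q /=; apply: fmorph_rat.
Qed.

Lemma rat_horner_transcendental (p : {poly rat}) :
  (1 < size p)%N -> ~ algebraic (rat_horner p)%:C.
Proof.
move=> p1 [q q0 qp]; apply: tt; exists (q \Po p).
  by rewrite comp_poly_eq0.
by rewrite map_comp_poly /root horner_comp -rat_hornerE.
Qed.

Lemma rat_horner_inj : injective rat_horner.
Proof.
move=> p q pq; apply/eqP; rewrite -subr_eq0; apply/negP => /negP pq0; apply: tt.
exists (p - q) => //; rewrite /root -rat_hornerE.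
have : rat_horner (p - q + q) = rat_horner q by rewrite subrK.
by rewrite rat_hornerD => /eqP; rewrite -subr_eq0 addrK => /eqP ->.
Qed.

Variable n : nat -> nat.
Hypotheses (n_inj : injective n) (n_gt0 : forall i, (0 < n i)%N).

(** Replaces each ['X^i] by ['X^(n i)], so that [{poly rat}] parametrizes the polynomials with
    exponents in the range of [n]. *)
Definition sparse_poly : {poly rat} -> {poly rat} := lincomb (fun i => 'X^(n i)).

Lemma coef_sparse_poly (p : {poly rat}) k :
  (sparse_poly p)`_k != 0 -> exists i, k = n i.
Proof.
move=> pk; apply: contrapT => nk; case/eqP: pk.
rewrite coef_sum big1// => i _; rewrite coefZ coefXn.
by case: eqP => [kn|_]; [case: nk; exists i|rewrite mulr0].
Qed.

Lemma coef_sparse_poly_n (p : {poly rat}) i : (sparse_poly p)`_(n i) = p`_i.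
Proof.
rewrite /sparse_poly (@lincomb_wide _ _ _ _ (maxn (size p) i.+1)) ?leq_maxl//.
have im : (i < maxn (size p) i.+1)%N by rewrite leq_maxr.
rewrite coef_sum (bigD1 (Ordinal im))//= coefZ coefXn eqxx mulr1.
rewrite big1 ?addr0// => j ij; rewrite coefZ coefXn (inj_eq n_inj).
by rewrite eq_sym -val_eqE in ij; rewrite (negbTE ij) mulr0.
Qed.

Lemma sparse_poly_inj : injective sparse_poly.
Proof. by move=> p q pq; apply/polyP => i; rewrite -(coef_sparse_poly_n p) pq coef_sparse_poly_n. Qed.

Lemma size_sparse_poly (p : {poly rat}) : p != 0 -> (1 < size (sparse_poly p))%N.
Proof.
(* A constant has no coefficient at the positive exponents [n i], where those of [p] are found. *)
move=> p0; rewrite ltnNge; apply/negP => /leq_sizeP sp; case/eqP: p0.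
by apply/polyP => i; rewrite coef0 -coef_sparse_poly_n sp.
Qed.

Definition power_map (p : {poly rat}) : R[i] := (rat_horner (sparse_poly p))%:C.

Definition power_group : set R[i] := range power_map.

Lemma power_mapD : {morph power_map : p q / p + q}.
Proof. by move=> p q; rewrite /power_map /sparse_poly lincombD rat_hornerD rmorphD. Qed.

Lemma power_map_inj : injective power_map.
Proof. by move=> p q [] /rat_horner_inj /sparse_poly_inj. Qed.

Lemma power_map0 : power_map 0 = 0.
Proof. by apply: (addrI (power_map 0)); rewrite -power_mapD !addr0. Qed.

Lemma power_mapB : {morph power_map : p q / p - q}.
Proof. by move=> p q; apply: (addIr (power_map q)); rewrite -power_mapD !subrK. Qed.

Lemma power_group_transcendental : transcendental_group power_group.
Proof.
split=> [|_ [p _ <-] p0].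
  split=> [|_ _ /set_mem[p _ <-] /set_mem[q _ <-]]; apply/mem_set.
    by exists 0; rewrite // power_map0.
  by exists (p - q); rewrite // power_mapB.
apply: rat_horner_transcendental; apply: size_sparse_poly; apply/eqP => pE.
by apply: p0; rewrite pE power_map0.
Qed.

Lemma power_group_isomorphic : group_isomorphic power_group {poly rat}.
Proof. exact: group_isomorphic_range power_map_inj power_mapD. Qed.

Lemma card_power_group : power_group #= [set: nat].
Proof.
have pi : {in [set: {poly rat}] &, injective power_map}.
  by move=> p q _ _; apply: power_map_inj.
rewrite (card_eql (inj_card_eq pi)); apply: eq_card_nat; first exact: countableP.
apply/infiniteP.
have Xi : {in [set: nat] &, injective (fun i => 'X^i : {poly rat})}.
  by move=> i j _ _ /(congr1 (fun p : {poly rat} => size p)); rewrite !size_polyXn => -[].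
have := inj_card_eq Xi; rewrite card_eq_le => /andP[_ XN].
exact: card_le_trans XN (card_leT _).
Qed.

(** The rational multiples of the single nonzero real number [t ^+ n 0] are already dense. *)
Lemma power_group_dense :
  dense_image (fun z : set_type power_group => complex.Re (val z)).
Proof.
have w0 : rat_horner 'X^(n 0) != 0.
  apply/eqP => w0; have /rat_horner_transcendental : (1 < size ('X^(n 0) : {poly rat}))%N.
    by rewrite size_polyXn ltnS.
  by rewrite w0; apply; apply: algebraic0.
move=> a b /(dense_ratr w0)[q qab].
have Gq : power_group (power_map q%:P) by exists q%:P.
exists (SigSub (mem_set Gq)) => /=; rewrite /power_map /sparse_poly /=.
(* The constant [q] is [q *: 'X^0], which [power_map] sends to [q] times [t ^+ n 0]. *)
by rewrite -[q%:P]mulr1 mul_polyC -(expr0 'X) lincombZX /rat_horner map_polyZ hornerZ.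
Qed.

Lemma power_group_homeomorphic :
  homeomorphic (set_type power_group) (set_type (range (ratr : rat -> R))).
Proof.
apply: dense_homeomorphic_rat power_group_dense => [|_ [p _ <-]//].
by rewrite (eq_countable card_power_group).
Qed.

(** With [power_group_mem], this recovers the set of exponents from the group: as evaluation at [t]
    is injective, ['X^k] itself must be a sparse polynomial. *)
Lemma power_groupX k : power_group (t ^+ k)%:C -> exists i, k = n i.
Proof.
move=> [p _ []]; have -> : t ^+ k = rat_horner 'X^k.
  by rewrite /rat_horner map_polyXn hornerXn.
move=> /rat_horner_inj pk; apply: (@coef_sparse_poly p).
by rewrite pk coefXn eqxx oner_neq0.
Qed.

Lemma power_group_mem i : power_group (t ^+ n i)%:C.
Proof.
exists 'X^i => //; rewrite /power_map /sparse_poly -['X^i]scale1r lincombZX scale1r.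
by rewrite /rat_horner map_polyXn hornerXn.
Qed.

End Powers.

(* The exponents record the integer parts of the multiples of [x], hence [x]. *)
Definition exponents (R : realType) (x : R) (i : nat) : nat :=
  (pickle (i, Num.floor (x * i.+1%:R))).+1.

Lemma exponents_inj (R : realType) (x : R) : injective (exponents x).
Proof. by move=> i j [] /(pcan_inj pickleK)[]. Qed.

Lemma exponents_sub_eq (R : realType) (x y : R) :
  (forall i, exists j, exponents x i = exponents y j) -> x = y.
Proof.
move=> xy; apply/eqP; rewrite -subr_eq0; apply/negP => /negP d0.
have {}d0 : 0 < `|x - y| by rewrite normr_gt0.
(* The Archimedean property makes [i], hence [i.+1], exceed the inverse of the distance. *)
pose i := Num.bound `|x - y|^-1.
have : 1 < `|x - y| * i.+1%:R.
  rewrite mulrC -ltr_pdivrMr// div1r; apply: (@lt_trans _ _ i%:R).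
    by apply: archi_boundP; rewrite invr_ge0.
  by rewrite ltr_nat.
(* The code of an exponent contains its index, so [j] is [i] and the two floors agree; the multiples
   then differ by at most 1. *)
apply/negP; rewrite -leNgt; have [j [/(pcan_inj pickleK)[<- fl]]] := xy i.
have /andP[xl xr] := floor_itv (x * i.+1%:R).
have /andP[yl yr] := floor_itv (y * i.+1%:R).
rewrite -fl in yl yr; rewrite -[i.+1%:R]ger0_norm// -normrM mulrBl.
rewrite ltW// ltr_distl; rewrite intrD in xr yr.
by rewrite ltrBlDr (lt_le_trans yr) ?lerD2r// (lt_le_trans xr) ?lerD2r.
Qed.

Theorem mainTheorem5 (R : realType) :
  exists S : set (set R[i]),
    S #= [set: R] /\
    forall G : set R[i], S G ->
      [/\ transcendental_group G,
          G #= [set: nat],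
          homeomorphic (set_type G) (set_type (range (ratr : rat -> R))),
          (exists V : lmodType (algebraic_number R),
             countably_infinite_dim V /\ group_isomorphic G V)
        & (exists W : lmodType rat,
             countably_infinite_dim W /\ group_isomorphic G W)].
Proof.
have [t tt] := exists_transcendental R.
exists (range (fun x : R => power_group t (exponents x))); split.
  (* Equal groups contain the same powers of [t], so the exponents of [x] are among those of [y],
     and the parametrization by [R] is injective. *)
  apply: inj_card_eq => x y _ _ /seteqP[xy _]; apply: exponents_sub_eq => i.
  exact/(power_groupX tt)/xy/power_group_mem.
move=> _ [x _ <-]; have xi := @exponents_inj R x.
have x0 i : (0 < exponents x i)%N by [].
have iso := power_group_isomorphic tt xi; split.
- exact: power_group_transcendental.
- exact: card_power_group.
- exact: power_group_homeomorphic.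
(* Over [rat], [{poly rat}] and the restriction of [{poly A}] both have countably infinite
   dimension; restricting scalars leaves the additive group unchanged. *)
- exists {poly algebraic_number R}; split; first exact: countably_infinite_dim_poly.
  have [f fbij fD] := countably_infinite_dim_isomorphic
    (countably_infinite_dim_poly rat) (countably_infinite_dim_poly_algebraic_rat R).
  exact: group_isomorphic_trans fbij fD iso.
- by exists {poly rat}; split=> //; apply: countably_infinite_dim_poly.
Qed.
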